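(* For $k\ge2$, the set $\mathcal{D}$ is a maximal commutative algebraic system in $\mathcal{P}_{4k+7}( * )$, where $n=4k+7$ and $\mathcal{D}=\bigcup_j\mathcal{D}_j$ with $\mathcal{D}_{2k+3}=\bigcup_{i=1}^{10}\mathcal{B}_i$, $\mathcal{D}_j=\mathcal{P}_n(j)$ if $j\ge 2k+5$ and $j$ is odd, and $\mathcal{D}_j=\emptyset$ otherwise.
   Context: Write $[a]=\{1,\dots,a\}$, $[a,b]=\{a,\dots,b\}$; $\mathcal{P}_n(j)$ is the collection of all subsets of $[n]$ of size $j$, and $\mathcal{P}_n( * )$ is the collection of all nonempty subsets of $[n]$. A nonempty collection $\Delta$ of subsets of $[n]$ of odd size is an algebraic system if for every $A_1\subseteq[n]$ with $|A_1|$ even and every $A_2\in\Delta$ with $A_1\cap A_2=\emptyset$ we have $A_1\cup A_2\in\Delta$. It is commutative if any two elements of $\Delta$ have nonempty intersection. A commutative system $\Delta$ is maximal if for every $A\subseteq[n]$ with $|A|$ odd and $A\notin\Delta$ there is $B\in\Delta$ with $A\cap B=\emptyset$. A maximal commutative algebraic system is an algebraic system that is commutative and maximal. With $n=4k+7$, put $\mathcal{S}'_7=[4k+1,4k+7]$ and define seven triples in it: $L_1=\{4k+1,4k+2,4k+5\}$, $L_2=\{4k+1,4k+3,4k+6\}$, $L_3=\{4k+1,4k+4,4k+7\}$, $L_4=\{4k+2,4k+3,4k+7\}$, $L_5=\{4k+3,4k+4,4k+5\}$, $L_6=\{4k+5,4k+6,4k+7\}$, $L_7=\{4k+2,4k+4,4k+6\}$.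 The collections $\mathcal{B}_i\subset\mathcal{P}_n(2k+3)$ are: for $1\le i\le 7$, $\mathcal{B}_i=\{L_i\cup S'\mid S'\subset[4k],\ |S'|=2k\}$; $\mathcal{B}_8=\{S'\cup S''\mid S'\subset\mathcal{S}'_7,\ S''\subset[4k],\ |S'|=2,\ |S''|=2k+1\}$; $\mathcal{B}_9=\{S'\cup S''\mid S'\subset\mathcal{S}'_7,\ S''\subset[4k],\ |S'|=1,\ |S''|=2k+2\}$; $\mathcal{B}_{10}=\{S\mid S\subset[4k],\ |S|=2k+3\}$. *)

(* Defs.v *)
From mathcomp Require Import all_boot.

Set Implicit Arguments.
Unset Strict Implicit.
Unset Printing Implicit Defensive.

(* The ground set [n] = {1, ..., n} is modelled by 'I_n: the ordinal x stands
   for the integer x.+1. *)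

Section Systems.
Variable n : nat.
Implicit Types (A B : {set 'I_n}) (Delta : {set {set 'I_n}}).

Definition subsets_of_size (j : nat) : {set {set 'I_n}} :=
  [set A : {set 'I_n} | #|A| == j].

Definition nonempty_subsets : {set {set 'I_n}} :=
  [set A : {set 'I_n} | A != set0].

Definition algebraic_system Delta : Prop :=
  [/\ Delta != set0,
      forall A, A \in Delta -> odd #|A|
    & forall A1 A2, ~~ odd #|A1| -> A2 \in Delta -> A1 :&: A2 = set0 ->
        A1 :|: A2 \in Delta].

Definition commutative_system Delta : Prop :=
  forall A B, A \in Delta -> B \in Delta -> A :&: B != set0.

Definition maximal_system Delta : Prop :=
  forall A, odd #|A| -> A \notin Delta ->
    exists2 B, B \in Delta & A :&: B = set0.

Definition maximal_commutative_algebraic_system Delta : Prop :=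
  [/\ algebraic_system Delta, commutative_system Delta & maximal_system Delta].

Definition subsets_in (E : {set 'I_n}) (m : nat) : {set {set 'I_n}} :=
  [set A : {set 'I_n} | (A \subset E) && (#|A| == m)].

Definition int_interval (a b : nat) : {set 'I_n} :=
  [set x : 'I_n | a <= x.+1 <= b].

Definition int_triple (a b c : nat) : {set 'I_n} :=
  [set x : 'I_n | x.+1 \in [:: a; b; c]].

End Systems.

Section FanoSystem.
Variable k : nat.
Let n := 4 * k + 7.

Definition S7 : {set 'I_n} := int_interval n (4 * k + 1) (4 * k + 7).

Definition base : {set 'I_n} := int_interval n 1 (4 * k).

(* Only the indices 1 <= i <= 7 are meaningful. *)
Definition L (i : nat) : {set 'I_n} :=
  match i with
  | 1 => int_triple n (4 * k + 1) (4 * k + 2) (4 * k + 5)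
  | 2 => int_triple n (4 * k + 1) (4 * k + 3) (4 * k + 6)
  | 3 => int_triple n (4 * k + 1) (4 * k + 4) (4 * k + 7)
  | 4 => int_triple n (4 * k + 2) (4 * k + 3) (4 * k + 7)
  | 5 => int_triple n (4 * k + 3) (4 * k + 4) (4 * k + 5)
  | 6 => int_triple n (4 * k + 5) (4 * k + 6) (4 * k + 7)
  | 7 => int_triple n (4 * k + 2) (4 * k + 4) (4 * k + 6)
  | _ => set0
  end.

(* Only the indices 1 <= i <= 10 are meaningful. *)
Definition B (i : nat) : {set {set 'I_n}} :=
  match i with
  | 8 => [set S' :|: S'' | S' in subsets_in S7 2,
                           S'' in subsets_in base (2 * k + 1)]
  | 9 => [set S' :|: S'' | S' in subsets_in S7 1,
                           S'' in subsets_in base (2 * k + 2)]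
  | 10 => subsets_in base (2 * k + 3)
  | _ => [set L i :|: S' | S' in subsets_in base (2 * k)]
  end.

Definition D_ (j : nat) : {set {set 'I_n}} :=
  if j == 2 * k + 3 then \bigcup_(1 <= i < 11) B i
  else if (2 * k + 5 <= j) && odd j then subsets_of_size n j
  else set0.

Definition D : {set {set 'I_n}} := \bigcup_(1 <= j < n.+1) D_ j.

End FanoSystem.

(* Main.v *)
Require Import Defs.
From mathcomp Require Import all_boot.
From mathcomp Require Import zify.

Set Implicit Arguments.
Unset Strict Implicit.
Unset Printing Implicit Defensive.

(** The seven triples are the lines of a Fano plane on [S7], and an odd set [A]
    lies in the system exactly when [#|A|] is at least [2k + 5], or [#|A|] is
    [2k + 3] and the trace of [A] on [S7] is a line or has at most two points
    ([mem_D]). With [n = 4k + 7] everything then reduces to counting and to two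
    properties of the plane.

    The system is closed under adding disjoint nonempty even sets because the
    result has at least [2k + 5] elements. Two disjoint members would have total
    size at most [n], which forces both to have size [2k + 3] and their union to
    miss a single point; their traces then have at least six points altogether,
    so both are lines, and any two lines meet ([lines_meet]).

    For maximality, let [A] be odd and outside the system. If [A] has at most
    [2k + 1] elements, its complement contains a set of size [2k + 5].
    Otherwise [#|A|] is [2k + 3] and the complement has one element too many.
    When the trace of [A] has at least four points, the trace of the complement
    has at most three, and deleting one point, taken in [S7] if possible,
    leaves a trace of at most two points. When the trace of [A] is a triple that
    is not a line, some line misses it ([line_or_missed_line]), and this line
    together with the [2k] elements of the base outside [A] is a member disjoint
    from [A]. *)

(** * Sets prescribed by their trace and their size *)

Lemma mem_bigcup_seq (T : finType) (I : Type) (r : seq I) (F : I -> {set T}) x :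
  (x \in \bigcup_(i <- r) F i) = has (fun i => x \in F i) r.
Proof.
by elim: r => [|i r IHr]; rewrite ?big_nil ?inE // big_cons inE IHr.
Qed.

Lemma subset_of_card (T : finType) (A : {set T}) m :
  m <= #|A| -> exists2 C : {set T}, C \subset A & #|C| = m.
Proof.
move=> le_mA; exists [set x in take m (enum A)].
  by apply/subsetP=> x; rewrite inE => /mem_take; rewrite mem_enum.
by rewrite cardsE (card_uniqP _) ?take_uniq ?enum_uniq // size_takel -?cardE.
Qed.

Section Traces.
Variables (n : nat) (E : {set 'I_n}).
Implicit Types (A S : {set 'I_n}) (F : {set {set 'I_n}}).

(** A union of a part inside [E] and a part outside determines both parts, so
    each of the families defined by such unions amounts to a condition on the
    trace and a condition on the size. *)
Lemma mem_setU_trace F m r A : F \subset subsets_in E m ->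
  (A \in [set S :|: S' | S in F, S' in subsets_in (~: E) r]) =
  (A :&: E \in F) && (#|A| == m + r).
Proof.
move=> /subsetP FE.
apply/imset2P/andP => [[S S' FS] | [FA /eqP sizeA]].
  have := FE _ FS; rewrite !inE => /andP[SE /eqP Sm] /andP[S'E /eqP S'r] ->.
  have S'E0 : S' :&: E = set0 by apply/eqP; rewrite setI_eq0 disjoints_subset.
  rewrite setIUl (setIidPl SE) S'E0 setU0 FS cardsU Sm S'r; split=> //.
  have -> : S :&: S' = set0.
    by apply/eqP; rewrite -subset0 -S'E0 setIC setIS.
  by rewrite cards0 subn0.
exists (A :&: E) (A :\: E) => //; last by rewrite setID.
rewrite inE setDE subsetIr -setDE /=.
have := FE _ FA; rewrite inE => /andP[_ /eqP sizeAE].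
by have := cardsID E A; rewrite sizeA sizeAE => /addnI ->.
Qed.

Lemma mem_setU_trace1 S r A : S \subset E ->
  (A \in [set S :|: S' | S' in subsets_in (~: E) r]) =
  (A :&: E == S) && (#|A| == #|S| + r).
Proof.
move=> SE; have -> : [set S :|: S' | S' in subsets_in (~: E) r] =
    [set S1 :|: S' | S1 in [set S], S' in subsets_in (~: E) r].
  by rewrite imset2_set1l.
by rewrite (@mem_setU_trace _ #|S|) ?sub1set !inE ?SE /=.
Qed.

End Traces.

(** * The Fano plane *)

(** The lines [L 1, ..., L 7], in this order, after subtracting [4k + 1] from
    every integer; plain lists of numbers make the finite checks below
    computations. *)
Definition fano : seq (seq nat) :=
  [:: [:: 0; 1; 4]; [:: 0; 2; 5]; [:: 0; 3; 6]; [:: 1; 2; 6]; [:: 2; 3; 4];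
      [:: 4; 5; 6]; [:: 1; 3; 5]].

Lemma fano_points l : l \in fano -> {subset l <= iota 0 7}.
Proof.
have /allP points : all (all (mem (iota 0 7))) fano by [].
by move=> /points/allP.
Qed.

Lemma fano_size : {in fano, forall l, (size l == 3) && uniq l}.
Proof. exact/allP. Qed.

Lemma fano_meet l m : l \in fano -> m \in fano -> has (mem l) m.
Proof.
have /allP meet : all (fun l => all (fun m => has (mem l) m) fano) fano by [].
by move=> /meet/allP; apply.
Qed.

(** Two lines meet in one point and three lines pass through each point, so a
    triple that is not a line is met by only [3 * 3 - 3 = 6] of the seven
    lines. *)
Lemma fano_contained_or_missed (b : pred nat) : count b (iota 0 7) = 3 ->
  has (all b) fano || has (all (predC b)) fano.
Proof.
rewrite /=; case: (b 0); case: (b 1); case: (b 2); case: (b 3); case: (b 4);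
  by case: (b 5); case: (b 6).
Qed.

Section FanoSystem.
Variable k : nat.
Local Notation n := (4 * k + 7).
Local Notation S7 := (S7 k).
Local Notation base := (base k).
Implicit Types (A B T : {set 'I_n}) (l : seq nat).

(** The integer [4k + 1 + j], which is the ordinal of value [4k + j]. *)
Definition point (j : nat) : 'I_n := rshift (4 * k) (inord j : 'I_7).
Definition line l : {set 'I_n} := [set x in map point l].

Lemma val_point j : j < 7 -> point j = 4 * k + j :> nat.
Proof. by move=> lt_j7; rewrite /= inordK. Qed.

Lemma point_inj : {in iota 0 7 &, injective point}.
Proof.
move=> i j; rewrite !mem_iota /= => lt_i7 lt_j7 /(congr1 val) /=.
by rewrite !inordK // => /addnI.
Qed.

Lemma point_of (x : 'I_n) : x \in S7 -> x = point (x - 4 * k).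
Proof.
by rewrite inE => x7; apply: ord_inj; rewrite val_point; lia.
Qed.

Lemma point_S7 j : j < 7 -> point j \in S7.
Proof. by move=> lt_j7; rewrite inE val_point //; lia. Qed.

Lemma baseE : base = ~: S7.
Proof. by apply/setP=> x; rewrite !inE; have := ltn_ord x; lia. Qed.

Lemma S7E : S7 = line (iota 0 7).
Proof.
apply/setP=> x; rewrite [RHS]inE; apply/idP/mapP => [x7 | [j]].
  exists (x - 4 * k); last exact: point_of.
  by move: x7; rewrite mem_iota inE; lia.
by rewrite mem_iota /= => lt_j7 ->; apply: point_S7.
Qed.

Lemma card_line l : {subset l <= iota 0 7} -> uniq l -> #|line l| = size l.
Proof.
move=> l7 uniq_l; rewrite cardsE (card_uniqP _) ?size_map //.
by rewrite map_inj_in_uniq // => i j li lj; apply: point_inj; apply: l7.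
Qed.

Lemma card_S7 : #|S7| = 7.
Proof. by rewrite S7E card_line. Qed.

Lemma card_base : #|base| = 4 * k.
Proof.
by have := cardsC S7; rewrite -baseE card_S7 card_ord addnC => /addIn.
Qed.

Lemma line_sub_S7 l : {subset l <= iota 0 7} -> line l \subset S7.
Proof.
move=> l7; rewrite S7E; apply/subsetP => x; rewrite !in_set.
by case/mapP=> j /l7 j7 ->; apply: map_f.
Qed.

Lemma card_fano_line l : l \in fano -> #|line l| = 3.
Proof.
move=> fano_l; have /andP[/eqP size_l uniq_l] := fano_size fano_l.
by rewrite card_line //; apply: fano_points.
Qed.

Lemma lines_meet l m : l \in fano -> m \in fano -> line l :&: line m != set0.
Proof.
move=> fano_l fano_m; have /hasP[j mj lj] := fano_meet fano_l fano_m.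
by apply/set0Pn; exists (point j); rewrite !inE !map_f.
Qed.

Lemma int_tripleE a b c : 0 < a <= 7 -> 0 < b <= 7 -> 0 < c <= 7 ->
  int_triple n (4 * k + a) (4 * k + b) (4 * k + c) =
  line [:: a.-1; b.-1; c.-1].
Proof.
move=> a7 b7 c7; apply/setP=> x; rewrite !inE.
by rewrite -!(inj_eq (@ord_inj _)) !val_point; lia.
Qed.

Lemma L_line i : 0 < i < 8 -> L k i = line (nth [::] fano i.-1).
Proof. by case: i => [|[|[|[|[|[|[|[|i]]]]]]]] // _; apply: int_tripleE. Qed.

(** Inside [S7] a set is known from seven booleans, which is what makes the case
    analysis of [fano_contained_or_missed] apply to it. *)
Lemma card_sub_S7 T : T \subset S7 ->
  #|T| = count (fun j => point j \in T) (iota 0 7).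
Proof.
move=> T7; rewrite -size_filter -card_line ?filter_uniq ?iota_uniq //.
  congr #|pred_of_set _|; apply/setP=> x; rewrite inE.
  apply/idP/mapP => [Tx | [j]]; last by rewrite mem_filter => /andP[Tj _] ->.
  have x7 := subsetP T7 x Tx; exists (x - 4 * k); last exact: point_of.
  rewrite mem_filter -point_of // Tx mem_iota.
  by move: x7; rewrite inE; lia.
by move=> j; rewrite mem_filter => /andP[].
Qed.

Lemma line_or_missed_line T : T \subset S7 -> #|T| = 3 ->
  has (fun l => T == line l) fano \/ exists2 l, l \in fano & T :&: line l = set0.
Proof.
move=> T7 T3; have := T3; rewrite card_sub_S7 //.
case/fano_contained_or_missed/orP => /hasP[l fano_l /allP Tl]; [left | right].
  apply/hasP; exists l => //; rewrite eq_sym eqEcard card_fano_line // T3 andbT.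
  by apply/subsetP=> x; rewrite inE => /mapP[j /Tl Tj ->].
exists l => //; apply/setP=> x; rewrite !inE.
by apply/andP=> -[Tx /mapP[j /Tl /negP Tj xj]]; rewrite xj in Tx.
Qed.

(** * Membership in the system *)

(** The traces on [S7] of the members of size [2k + 3]. *)
Definition small_trace T :=
  (#|T| <= 2) || has (fun l => T == line l) fano.

Lemma small_trace_card T : small_trace T -> #|T| <= 3.
Proof.
case/orP=> [/leq_trans-> // | /hasP[l fano_l /eqP->]].
by rewrite card_fano_line.
Qed.

Lemma mem_B_line i A : 0 < i < 8 ->
  (A \in B k i) = (A :&: S7 == L k i) && (#|A| == 2 * k + 3).
Proof.
move=> i7; have -> : B k i = [set L k i :|: S | S in subsets_in base (2 * k)].
  by move: i i7; do 8!case=> //.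
have fano_i : nth [::] fano i.-1 \in fano by apply: mem_nth; rewrite /=; lia.
rewrite L_line // baseE mem_setU_trace1 ?line_sub_S7 //; last exact: fano_points.
by rewrite card_fano_line // (addnC 3).
Qed.

Lemma mem_B_subsets A s r :
  (A \in [set S :|: S' | S in subsets_in S7 s, S' in subsets_in base r]) =
  (#|A :&: S7| == s) && (#|A| == s + r).
Proof. by rewrite baseE (mem_setU_trace _ _ (subxx _)) inE subsetIr. Qed.

Lemma mem_B10 A : (A \in B k 10) = (#|A :&: S7| == 0) && (#|A| == 2 * k + 3).
Proof.
by rewrite inE baseE -disjoints_subset -setI_eq0 cards_eq0.
Qed.

(** Traces of size two, one and zero come from [B 8], [B 9] and [B 10]; the
    base part is chosen so that the total is [2k + 3] in each case, so only the
    condition on the trace differs between the ten families. *)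
Lemma mem_D_middle A :
  (A \in D_ k (2 * k + 3)) = (#|A| == 2 * k + 3) && small_trace (A :&: S7).
Proof.
rewrite /D_ eqxx mem_bigcup_seq /index_iota [iota _ _]/= /has.
rewrite [A \in B k 8]mem_B_subsets [A \in B k 9]mem_B_subsets mem_B10.
rewrite !mem_B_line // !L_line //.
rewrite /small_trace [has _ fano]/=.
have -> : 2 + (2 * k + 1) = 2 * k + 3 by lia.
have -> : 1 + (2 * k + 2) = 2 * k + 3 by lia.
case: (#|A| == _); rewrite ?andbF ?andbT //=.
by case: #|A :&: S7| => [|[|[|m]]] /=; rewrite ?orbT ?orbF.
Qed.

Lemma mem_D A :
  (A \in D k) = odd #|A| &&
    ((2 * k + 5 <= #|A|) || (#|A| == 2 * k + 3) && small_trace (A :&: S7)).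
Proof.
have leAn : #|A| <= n by have := max_card (mem A); rewrite card_ord.
have mem_D_ j : (A \in D_ k j) = (j == #|A|) && (odd j &&
    ((2 * k + 5 <= j) || (j == 2 * k + 3) && small_trace (A :&: S7))).
  have [-> | ne_j] := eqVneq j (2 * k + 3).
    by rewrite mem_D_middle eq_sym; case: eqP => //= _; case: small_trace; lia.
  rewrite /D_ (negPf ne_j) orbF [odd j && _]andbC; case: ifP => _; rewrite inE.
    by rewrite andbT eq_sym.
  by rewrite andbF.
rewrite mem_bigcup_seq (eq_has mem_D_).
apply/hasP/idP => [[j _ /andP[/eqP->]] // | A_ok].
by exists #|A|; rewrite ?eqxx // mem_index_iota; move: A_ok; case: #|A| leAn.
Qed.

(** * The three properties of the system *)

Lemma D_algebraic_system : algebraic_system (D k).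
Proof.
split=> [|A|A1 A2]; rewrite ?mem_D.
- by apply/set0Pn; exists setT; rewrite mem_D cardsT card_ord; lia.
- by case/andP.
have [-> _ | A1n0] := eqVneq A1 set0; first by rewrite set0U.
have : 0 < #|A1| by rewrite card_gt0.
move=> A1gt0 even1 /andP[odd2 size2] A12.
have sizeU : #|A1 :|: A2| = #|A1| + #|A2| by rewrite cardsU A12 cards0 subn0.
rewrite sizeU; case: small_trace size2; rewrite ?andbF ?andbT;
  by case: small_trace; lia.
Qed.

Lemma D_commutative : commutative_system (D k).
Proof.
move=> A B; rewrite !mem_D => /andP[_ sizeA] /andP[_ sizeB].
apply/negP=> /eqP AB0.
have le_n : #|A| + #|B| <= n.
  by have := max_card (mem (A :|: B)); rewrite cardsU AB0 cards0 card_ord subn0.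
have [/eqP A3 trA] : #|A| == 2 * k + 3 /\ small_trace (A :&: S7).
  by apply/andP; move: sizeA sizeB; do 2!case: small_trace; lia.
have [/eqP B3 trB] : #|B| == 2 * k + 3 /\ small_trace (B :&: S7).
  by apply/andP; move: sizeB; case: small_trace; lia.
have AB7 : (A :&: S7) :&: (B :&: S7) = set0 by rewrite setIACA AB0 set0I.
(* The union misses a single point of the ground set, hence at most one of the
   seven points of [S7]. *)
have : 6 <= #|A :&: S7| + #|B :&: S7|.
  have := cardsID S7 (A :|: B); rewrite cardsU AB0 cards0 A3 B3.
  have := cardsU (A :&: S7) (B :&: S7); rewrite AB7 cards0 -setIUl => ->.
  have : #|(A :|: B) :\: S7| <= #|base|.
    by rewrite baseE setDE subset_leq_card ?subsetIr.
  by rewrite card_base; lia.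
have := small_trace_card trA; have := small_trace_card trB.
case/orP: trA => [|/hasP[l fano_l /eqP Al]]; first by lia.
case/orP: trB => [|/hasP[m fano_m /eqP Bm]]; first by lia.
by move: (lines_meet fano_l fano_m); rewrite -Al -Bm AB7 eqxx.
Qed.

(** Deleting a point of [S7] whenever the trace has one brings a trace of at
    most three points down to at most two. *)
Lemma middle_subset (C : {set 'I_n}) : #|C| = 2 * k + 4 -> #|C :&: S7| <= 3 ->
  exists2 B, B \in D k & B \subset C.
Proof.
move=> sizeC trC.
have [x Cx trCx] : exists2 x, x \in C & #|(C :\ x) :&: S7| <= 2.
  have [C0 | [x]] := set_0Vmem (C :&: S7).
    have /card_gt0P[x Cx] : 0 < #|C| by rewrite sizeC addn4.
    exists x => //; have := subset_leq_card (setSI S7 (subD1set C x)).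
    by rewrite C0 cards0; lia.
  move=> C7x; exists x; first by move: C7x; rewrite inE => /andP[].
  by rewrite setIDAC; have := cardsD1 x (C :&: S7); rewrite C7x; lia.
exists (C :\ x); last exact: subD1set.
have := cardsD1 x C; rewrite Cx sizeC mem_D /small_trace trCx /=.
by lia.
Qed.

Lemma D_maximal : maximal_system (D k).
Proof.
move=> A oddA; rewrite mem_D oddA /= negb_or -ltnNge => /andP[ltA notA].
have sizeCA : #|A| + #|~: A| = n by rewrite cardsC card_ord.
suff [B DB BCA] : exists2 B, B \in D k & B \subset ~: A.
  by exists B => //; apply/eqP; rewrite setI_eq0 disjoint_sym disjoints_subset.
have [sizeA | ne_sizeA] := eqVneq #|A| (2 * k + 3); last first.
  have [C CCA sizeC] :
      exists2 C : {set 'I_n}, C \subset ~: A & #|C| = 2 * k + 5.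
    apply: subset_of_card; move: oddA ltA ne_sizeA sizeCA => /=; lia.
  by exists C => //; rewrite mem_D sizeC; lia.
move: notA; rewrite sizeA eqxx /= negb_or -ltnNge => /andP[tr3 not_line].
have trCA : #|A :&: S7| + #|~: A :&: S7| = 7.
  by have := cardsID A S7; rewrite card_S7 setDE ![S7 :&: _]setIC.
have [trA | ne_tr3] := eqVneq #|A :&: S7| 3; last first.
  by apply: middle_subset; lia.
have [|[l fano_l Al0]] := line_or_missed_line (subsetIr A S7) trA.
  by rewrite (negPf not_line).
have l7 : line l \subset S7 by apply/line_sub_S7/fano_points.
have lCA : line l \subset ~: A.
  by rewrite -disjoints_subset -setI_eq0 setIC -{1}(setIidPr l7) setIA Al0.
exists (line l :|: (~: A :\: S7)); last by rewrite subUset lCA subsetDl.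
have tr : (line l :|: (~: A :\: S7)) :&: S7 = line l.
  rewrite setIUl (setIidPl l7) setDE -setIA [~: S7 :&: _]setIC setICr.
  by rewrite setI0 setU0.
have size_l : #|line l :|: (~: A :\: S7)| = 2 * k + 3.
  rewrite -(cardsID S7) tr setDUl (eqP (_ : line l :\: S7 == set0)) ?setD_eq0 //.
  rewrite set0U setDDl setUid card_fano_line //.
  by have := cardsID S7 (~: A); lia.
have line_l : has (fun m => line l == line m) fano by apply/hasP; exists l.
by rewrite mem_D size_l eqxx tr /small_trace line_l !orbT; lia.
Qed.

End FanoSystem.

Theorem theorem4 (k : nat) (hk : 2 <= k) :
  D k \subset nonempty_subsets (4 * k + 7) /\
  maximal_commutative_algebraic_system (D k).
Proof.
split.
  apply/subsetP=> A; rewrite mem_D inE => /andP[oddA _].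
  by apply: contraTneq oddA => ->; rewrite cards0.
by split; [apply: D_algebraic_system | apply: D_commutative | apply: D_maximal].
Qed.
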